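(* Let $n\ge 2$, let $D=dH-\sum_{j=1}^s m_jE_j\in \operatorname{Pic}(X_{n,s})$ be a divisor with $d\ge m_j\ge 0$ for all $j$, satisfying $\operatorname{adeg}(D)=c+2$ and $\langle D,D\rangle=c+e$ for two integers $c$ and $e$ with $-2\le c\le 1$ and $-2\le e\le 1$. When $d=1$ assume further that $\langle D,D\rangle<0$. Then: (a) if $s\le n$, then $m_1+\dots+m_s>(n-1)d$; (b) if $s\ge n+1$, then after reordering the indices so that $m_1\ge m_2\ge\dots\ge m_s$ one has $m_1+\dots+m_{n+1}>(n-1)d$.
   Context: $X_{n,s}$ denotes the blow up of $\mathbb{P}^n$ at $s$ points $p_1,\dots,p_s$ in general position. $\operatorname{Pic}(X_{n,s})$ is the free abelian group with basis $H,E_1,\dots,E_s$, where $H$ is the class of a general hyperplane and $E_j$ is the exceptional divisor over $p_j$. The Dolgachev-Mukai pairing is the symmetric bilinear form on $\operatorname{Pic}(X_{n,s})$ given by $\langle H,H\rangle=n-1$, $\langle H,E_j\rangle=0$, $\langle E_i,E_j\rangle=-\delta_{i,j}$. With $K_{X_{n,s}}=-(n+1)H+(n-1)\sum_j E_j$, the anticanonical degree is $\operatorname{adeg}(D)=\frac{1}{n-1}\langle D,-K_{X_{n,s}}\rangle$. Explicitly, for $D=dH-\sum_j m_jE_j$: $\langle D,D\rangle=(n-1)d^2-\sum_j m_j^2$ and $\operatorname{adeg}(D)=(n+1)d-\sum_j m_j$. *)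

(* Defs.v *)
From mathcomp Require Import all_boot all_order all_fingroup all_algebra.
From mathcomp Require Import ring.

Set Implicit Arguments.
Unset Strict Implicit.
Unset Printing Implicit Defensive.

Import Order.TTheory GRing.Theory Num.Theory.
Local Open Scope ring_scope.

(* Pic(X_{n,s}) for the blow up X_{n,s} of P^n at s points in general position,
   as the free abelian group on H, E_1, ..., E_s: coordinate 0 is the
   coefficient of H, and coordinate 1 + j that of the exceptional class over
   the j-th point. As a group it depends only on s; n enters through the
   pairing and the canonical class. *)
Definition Pic (n s : nat) := 'rV[int]_(1 + s).

Definition Hcl (n s : nat) : Pic n s := delta_mx 0 (lshift s 0).
Definition Ecl (n s : nat) (j : 'I_s) : Pic n s := delta_mx 0 (rshift 1 j).

(* Gram matrix of the Dolgachev-Mukai pairing in the basis H, E_1, ..., E_s. *)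
Definition dm_gram (n s : nat) : 'M[int]_(1 + s) :=
  block_mx (n%:Z - 1)%:M 0 0 (- 1%:M).

Definition dm_pairing (n s : nat) (D D' : Pic n s) : int :=
  (D *m dm_gram n s *m D'^T) 0 0.
Arguments dm_pairing n {s} D D'.

Definition canonical_class (n s : nat) : Pic n s :=
  - ((n%:Z + 1) *: Hcl n s) + (n%:Z - 1) *: \sum_(j < s) Ecl n j.

(* Rational-valued, so that 1 / (n - 1) is a genuine division. *)
Definition adeg (n s : nat) (D : Pic n s) : rat :=
  (dm_pairing n D (- canonical_class n s))%:~R / (n%:Z - 1)%:~R.
Arguments adeg n {s} D.

Lemma sum_EclE n s (m : 'I_s -> int) :
  \sum_(j < s) m j *: Ecl n j = row_mx 0 (\row_j m j).
Proof.
apply/rowP => k; rewrite summxE mxE.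
case: splitP => i ki; rewrite !mxE.
  apply: big1 => j _; rewrite !mxE /=.
  by case: eqP => [kj|_]; [move: ki; rewrite kj /= ord1 | rewrite mulr0].
rewrite (bigD1 i) //= big1 => [|j ji]; rewrite !mxE /=.
  by rewrite (_ : k = rshift 1 i) ?eqxx ?mulr1 ?addr0 //; apply: val_inj.
case: eqP => [kj|_]; last by rewrite mulr0.
by case/eqP: ji; apply: val_inj; move: ki; rewrite kj /= => -[].
Qed.

Lemma HclE n s : Hcl n s = row_mx 1%:M 0.
Proof.
rewrite /Hcl delta_mx_lshift; congr row_mx.
by apply/matrixP => a b; rewrite !mxE !ord1.
Qed.

Lemma divisorE n s (d : int) (m : 'I_s -> int) :
  d *: Hcl n s - \sum_(j < s) m j *: Ecl n j
    = row_mx d%:M (- \row_j m j).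
Proof.
by rewrite sum_EclE HclE scale_row_mx scaler0 opp_row_mx add_row_mx oppr0 addr0
  add0r scalemx1.
Qed.

Lemma dm_pairing_row n s (d d' : int) (u u' : 'rV[int]_s) :
  dm_pairing n (row_mx d%:M u) (row_mx d'%:M u')
    = (n%:Z - 1) * d * d' - \sum_(j < s) u 0 j * u' 0 j.
Proof.
rewrite /dm_pairing /dm_gram mul_row_block !mulmx0 addr0 add0r mulmxN mulmx1.
rewrite tr_row_mx mul_row_col -scalar_mxM tr_scalar_mx -scalar_mxM mulNmx !mxE.
by rewrite mulr1n mulrC [d * _]mulrC mulrC; congr (_ - _);
  apply: eq_bigr => j _; rewrite mxE.
Qed.

Lemma dm_pairing_HH n s : dm_pairing n (Hcl n s) (Hcl n s) = n%:Z - 1.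
Proof.
by rewrite HclE dm_pairing_row big1 ?subr0 ?mulr1 // => j _; rewrite mxE mul0r.
Qed.

Lemma EclE n s (j : 'I_s) : Ecl n j = row_mx 0%:M (delta_mx 0 j).
Proof.
rewrite -[Ecl n j]/(delta_mx 0 (rshift 1 j)) delta_mx_rshift.
by congr row_mx; apply/matrixP => a b; rewrite !mxE mul0rn.
Qed.

Lemma dm_pairing_HE n s (j : 'I_s) : dm_pairing n (Hcl n s) (Ecl n j) = 0.
Proof.
by rewrite HclE EclE dm_pairing_row mulr0 big1 ?subr0 // => i _;
  rewrite mxE mul0r.
Qed.

Lemma dm_pairing_EE n s (i j : 'I_s) :
  dm_pairing n (Ecl n i) (Ecl n j) = - (i == j)%:R.
Proof.
rewrite !EclE dm_pairing_row !mulr0 sub0r (bigD1 i) //= big1 => [|k ki].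
  by rewrite !mxE !eqxx /= mul1r addr0.
by rewrite !mxE eqxx /= (negPf ki) mul0r.
Qed.

Lemma dm_pairing_self n s (d : int) (m : 'I_s -> int)
    (D := d *: Hcl n s - \sum_(j < s) m j *: Ecl n j) :
  dm_pairing n D D = (n%:Z - 1) * d ^+ 2 - \sum_(j < s) m j ^+ 2.
Proof.
rewrite /D divisorE dm_pairing_row -mulrA -expr2; congr (_ - _).
by apply: eq_bigr => j _; rewrite !mxE mulrNN -expr2.
Qed.

Lemma adegE n s (d : int) (m : 'I_s -> int) : (2 <= n)%N ->
  adeg n (d *: Hcl n s - \sum_(j < s) m j *: Ecl n j)
    = ((n%:Z + 1) * d - \sum_(j < s) m j)%:~R.
Proof.
move=> n2; rewrite /adeg.
have -> : - canonical_class n s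
    = row_mx (n%:Z + 1)%:M (- \row_(j < s) (n%:Z - 1)).
  rewrite -(divisorE n) /canonical_class opprD opprK; congr (_ - _).
  by rewrite scaler_sumr.
rewrite divisorE dm_pairing_row.
have -> : (n%:Z - 1) * d * (n%:Z + 1)
    - \sum_(j < s) (- \row_j m j) 0 j * (- \row_(j < s) (n%:Z - 1)) 0 j
    = ((n%:Z + 1) * d - \sum_(j < s) m j) * (n%:Z - 1).
  rewrite [RHS]mulrBl mulr_suml; congr (_ - _); first by ring.
  by apply: eq_bigr => j _; rewrite !mxE mulrNN.
rewrite intrM mulfK // intr_eq0 subr_eq0.
by case: n n2 => [|[]].
Qed.

(* Main.v *)
Require Import Defs.
From mathcomp Require Import all_boot all_order all_fingroup all_algebra.
From mathcomp Require Import ring zify.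

(** Write [T] and [Q] for the sums of the [m_j] and of the [m_j ^ 2], so that
    [T = (n + 1) d - (c + 2)] and [Q = (n - 1) d ^ 2 - (c + e)].

    For the whole family, [T > (n - 1) d] amounts to [2 d > c + 2], which the
    bound [c <= 1] gives as soon as [d >= 2]. The value [d <= 0] cannot occur:
    it would force [m = 0], hence [d = 0], [c = -2] and [e = 2], contrary to
    [e <= 1]. If [d = 1], all
    the [m_j] are 0 or 1, so [T = Q], which says [e = 0]; the assumption on
    [<D, D>] then reads [c < 0]. This is [total_multiplicity_gt], and
    it settles (a).

    For (b), let [M] be the sum of the [n + 1] largest multiplicities and [mu]
    the smallest of these. A convexity bound on [Q]
    ([sum_sqr_le_threshold]), in which the term [mu T - mu (n + 1) d] collapses
    to [- mu (c + 2)], reads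
      [d ((n - 1) d - M) <= (c + e) - mu (c + 2)].
    If [mu >= 1], the right-hand side is at most [e - 2 < 0], so
    [M > (n - 1) d]. If [mu = 0], all the other multiplicities vanish, so
    [M = T] and the bound on the whole family applies. *)

Set Implicit Arguments.
Unset Strict Implicit.
Unset Printing Implicit Defensive.

Import Order.TTheory GRing.Theory Num.Theory.
Local Open Scope ring_scope.

(** On [mu, d] the square function lies below its chord
    [x |-> (d + mu) x - d mu], and on [0, mu] it lies below the chord
    [x |-> mu x]; the bound is the sum of these chords. *)
Lemma sum_sqr_le_threshold (R : realDomainType) (I : finType) (P : pred I)
    (f : I -> R) (mu d : R) :
  (forall i, P i -> mu <= f i <= d) ->
  (forall i, ~~ P i -> 0 <= f i <= mu) ->
  \sum_i f i ^+ 2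
    <= d * \sum_(i | P i) f i + mu * (\sum_i f i - d *+ #|P|).
Proof.
move=> ftop frest.
have top : \sum_(i | P i) f i ^+ 2
    <= (d + mu) * \sum_(i | P i) f i - (d * mu) *+ #|P|.
  rewrite mulr_sumr -sumr_const -sumrB; apply: ler_sum => i /ftop /andP[lo hi].
  have : 0 <= (f i - mu) * (d - f i) by rewrite mulr_ge0 // subr_ge0.
  rewrite -subr_ge0; congr (0 <= _); ring.
have rest : \sum_(i | ~~ P i) f i ^+ 2 <= mu * \sum_(i | ~~ P i) f i.
  rewrite mulr_sumr; apply: ler_sum => i /frest /andP[lo hi].
  by rewrite expr2 ler_wpM2r.
rewrite (bigID P) [X in mu * (X - _)](bigID P) /=.
apply: le_trans (lerD top rest) _; rewrite le_eqVlt; apply/orP; left; apply/eqP.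
rewrite -mulr_natr -[d *+ _]mulr_natr; ring.
Qed.

(** Substituting the value of the sum, the claim is [c + 2 < 2 * d]. The sum of
    squares matters only for [d <= 1]: it excludes [d = 0], and it identifies
    [c + e] with [c] when [d = 1]. *)
Lemma total_multiplicity_gt (I : finType) (n : nat) (d : int) (m : I -> int)
    (c e : int) :
  (forall j, 0 <= m j <= d) -> -2 <= c <= 1 -> e <= 1 ->
  \sum_j m j = (n%:Z + 1) * d - (c + 2) ->
  \sum_j m j ^+ 2 = (n%:Z - 1) * d ^+ 2 - (c + e) ->
  (d = 1 -> c + e < 0) ->
  (n%:Z - 1) * d < \sum_j m j.
Proof.
move=> hm hc he hT hQ hd1.
have d_gt0 : 0 < d.
  rewrite ltNge; apply/negP => d_le0.
  have m0 j : m j = 0 by have := hm j; lia.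
  have T0 : \sum_j m j = 0 by apply: big1.
  have Q0 : \sum_j m j ^+ 2 = 0 by apply: big1 => j _; rewrite m0.
  (* For an empty family the sign of [d] is known only through [T]. *)
  have d0 : d = 0 by move: hT; rewrite T0; nia.
  by move: hT hQ; rewrite T0 Q0 d0 !mulr0; lia.
suff : c + 2 < 2 * d by rewrite hT; lia.
have [d_ge2|d_lt2] := lerP 2 d; first by lia.
have d1 : d = 1 by lia.
have QT : \sum_j m j ^+ 2 = \sum_j m j.
  apply: eq_bigr => j _.
  by have [->|->] : m j = 0 \/ m j = 1 by have := hm j; lia.
by move: hQ (hd1 d1); rewrite QT hT d1 expr1n !mulr1; lia.
Qed.

Lemma card_ord_lt (k s : nat) : (k <= s)%N -> #|[pred i : 'I_s | (i < k)%N]| = k.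
Proof.
move=> ks; rewrite -sum1_card -(big_ord_widen s (fun=> 1%N) ks).
by rewrite sum1_card card_ord.
Qed.

(** The value of [f] at index [n], the smallest of the leading [n + 1], serves as
    the threshold [mu]. It measures what the tail can contribute: nothing if
    [mu = 0], and if [mu >= 1] then each unit of [mu] costs [c + 2 >= 0] in the
    threshold bound, more than [c + e] can afford. *)
Lemma leading_multiplicities_gt (n s : nat) (d : int) (f : 'I_s -> int)
    (c e : int) :
  (n < s)%N -> (forall i, 0 <= f i <= d) ->
  (forall i j : 'I_s, (i <= j)%N -> f j <= f i) ->
  -2 <= c <= 1 -> e <= 1 ->
  \sum_i f i = (n%:Z + 1) * d - (c + 2) ->
  \sum_i f i ^+ 2 = (n%:Z - 1) * d ^+ 2 - (c + e) ->
  (d = 1 -> c + e < 0) ->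
  (n%:Z - 1) * d < \sum_(i < s | (i < n.+1)%N) f i.
Proof.
move=> ns hf fdecr hc he hT hQ hd1.
pose mu := f (Ordinal ns).
have ftop (i : 'I_s) : (i < n.+1)%N -> mu <= f i <= d.
  by move=> i_le; rewrite fdecr //=; case/andP: (hf i).
have frest (i : 'I_s) : ~~ (i < n.+1)%N -> 0 <= f i <= mu.
  rewrite -leqNgt => i_gt; rewrite fdecr //= ?(ltnW i_gt) // andbT.
  by case/andP: (hf i).
have /andP[mu_ge0 _] := hf (Ordinal ns); rewrite -/mu in mu_ge0.
have [mu0|mu_neq0] := eqVneq mu 0.
  have <- : \sum_i f i = \sum_(i < s | (i < n.+1)%N) f i.
    rewrite (bigID (fun i : 'I_s => (i < n.+1)%N)) /= [X in _ + X]big1 ?addr0 //.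
    by move=> i /frest; rewrite mu0 => /le_anti <-.
  exact: total_multiplicity_gt hf hc he hT hQ hd1.
have d_ge0 : 0 <= d by case/andP: (hf (Ordinal ns)); exact: le_trans.
have := sum_sqr_le_threshold ftop frest.
rewrite card_ord_lt // hT hQ -mulr_natr.
set M := \sum_(i < s | _) f i => chord.
have bound : d * ((n%:Z - 1) * d - M) <= (c + e) - mu * (c + 2).
  rewrite -subr_ge0; move: chord; rewrite -subr_ge0; congr (0 <= _).
  rewrite -natr1 natz; ring.
have rhs_lt0 : (c + e) - mu * (c + 2) < 0 by nia.
rewrite ltNge; apply/negP => M_le.
have : 0 <= d * ((n%:Z - 1) * d - M) by rewrite mulr_ge0 // subr_ge0.
by move/le_trans/(_ bound); rewrite leNgt rhs_lt0.
Qed.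

Theorem theorem0p6 (n s : nat) (hn : (2 <= n)%N)
    (d : int) (m : 'I_s -> int) (D : Pic n s)
    (hD : D = d *: Hcl n s - \sum_(j < s) m j *: Ecl n j)
    (hm : forall j : 'I_s, 0 <= m j <= d)
    (c e : int) (hc : -2 <= c <= 1) (he : -2 <= e <= 1)
    (hadeg : adeg n D = (c + 2)%:~R)
    (hself : dm_pairing n D D = c + e)
    (hd1 : d = 1 -> dm_pairing n D D < 0) :
  ((s <= n)%N -> \sum_(j < s) m j > (n%:Z - 1) * d) /\
  ((n.+1 <= s)%N ->
    forall sigma : {perm 'I_s},
      (forall i j : 'I_s, (i <= j)%N -> m (sigma j) <= m (sigma i)) ->
      \sum_(i < s | (i < n.+1)%N) m (sigma i) > (n%:Z - 1) * d).

Proof.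
have hT : \sum_j m j = (n%:Z + 1) * d - (c + 2).
  by move: hadeg; rewrite hD adegE // => /intr_inj <-; rewrite subKr.
have hQ : \sum_j m j ^+ 2 = (n%:Z - 1) * d ^+ 2 - (c + e).
  by rewrite -hself hD dm_pairing_self subKr.
have {}hd1 : d = 1 -> c + e < 0 by rewrite -hself.
have {}he : e <= 1 by case/andP: he.
split=> [_|ns sigma sorted_m].
  exact: total_multiplicity_gt hm hc he hT hQ hd1.
apply: leading_multiplicities_gt ns (fun i => hm (sigma i)) sorted_m hc he _ _ hd1.
  by rewrite -hT [RHS](reindex_inj (@perm_inj _ sigma)).
by rewrite -hQ [RHS](reindex_inj (@perm_inj _ sigma)).
Qed.
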